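(* Let $V$ be a vector space over $\mathbb{F}$ equipped with two bilinear operations $\ast$ and $\circ$, and let $A=\mathbb{F}[\partial]V$ be the free $\mathbb{F}[\partial]$-module over $V$. Define a $\lambda$-product $A\times A\to A[\lambda]$ on $A$ by $$u_\lambda v=u\ast v+\partial(u\circ v)+\lambda(u\circ v-v\circ u),\qquad u,v\in V,$$ extended to all of $A$ by conformal sesquilinearity. Then $A$ with this $\lambda$-product is a quadratic Jacobi-Jordan conformal algebra if and only if $(V,\ast,\circ)$ is a mock-Gel'fand Dorfman bialgebra.
   Context: $\mathbb{F}$ is a field of characteristic $0$. A conformal algebra is an $\mathbb{F}[\partial]$-module $A$ with an $\mathbb{F}$-bilinear map $A\times A\to A[\lambda]$, $(a,b)\mapsto a_\lambda b$ (the $\lambda$-product), satisfying conformal sesquilinearity: $(\partial a)_\lambda b=-\lambda\, a_\lambda b$ and $a_\lambda(\partial b)=(\lambda+\partial)(a_\lambda b)$. If $a_\lambda b=\sum_n \frac{\lambda^n}{n!}a_{(n)}b$, then $a_{-\lambda-\partial}b:=\sum_n\frac{(-\lambda-\partial)^n}{n!}(a_{(n)}b)$. A Jacobi-Jordan conformal algebra is a conformal algebra such that for all $a,b,c$: $a_\lambda b=b_{-\lambda-\partial}a$ and $a_\lambda(b_\mu c)+(a_\lambda b)_{\lambda+\mu}c+b_\mu(a_\lambda c)=0$. A Jacobi-Jordan conformal algebra $A$ is called quadratic if there is a vector space $V$ such that $A=\mathbb{F}[\partial]V$ is the free $\mathbb{F}[\partial]$-module over $V$ and for all $a,b\in V$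 one has $a_\lambda b=\partial u+\lambda v+w$ for some $u,v,w\in V$. A Jacobi-Jordan algebra is a vector space with a commutative bilinear product $\ast$ satisfying $a\ast(b\ast c)+b\ast(c\ast a)+c\ast(a\ast b)=0$. An anti-Novikov algebra is a vector space $A$ with a bilinear product $\circ$ such that for all $a,b,c\in A$: $a\circ(b\circ c)=-b\circ(a\circ c)$ and $(a,b,c)^-_\circ+(a,c,b)^-_\circ=0$, where $(a,b,c)^-_\circ=(a\circ b)\circ c+a\circ(b\circ c)$. A mock-Gel'fand Dorfman bialgebra (mock-GD bialgebra) is a vector space $A$ with two bilinear operations $\ast,\circ$ such that $(A,\circ)$ is an anti-Novikov algebra, $(A,\ast)$ is a Jacobi-Jordan algebra, and for all $a,b,c\in A$: $$a\circ(b\ast c)+a\ast(b\circ c)+(a\ast b)\circ c+b\circ(a\ast c)+b\ast(a\circ c)=0.$$ *)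

(* Defs.v *)
From HB Require Import structures.
From mathcomp Require Import all_boot all_order all_algebra.
From mathcomp Require Import finmap monalg.

Set Implicit Arguments.
Unset Strict Implicit.
Unset Printing Implicit Defensive.

Import GRing.Theory.
Local Open Scope ring_scope.

(* If M is an R-module then M[X] is a module over R[X].  Iterating this gives *)
(*   F[d]V          := modpoly V                     over {poly F},           *)
(*   A[lambda]      := modpoly A                     over {poly {poly F}},    *)
(*   A[lambda, mu]  := modpoly (modpoly A)           over {poly {poly {poly F}}} *)
(* where V is an F-module and A is an F[d]-module, i.e. an lmodType {poly F}.  *)
(* The last variable added is 'X, the previous one 'X%:P, and so on.          *)
Definition modpoly (R : nzRingType) (M : lmodType R) := {malg M[nat]}.

Section ModPoly.
Variables (R : nzRingType) (M : lmodType R).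
Implicit Types (p q : {poly R}) (f g : modpoly M).

HB.instance Definition _ := GRing.Zmodule.copy (modpoly M) {malg M[nat]}.

Definition modpoly_scale p f : modpoly M :=
  \sum_(i < size p) \sum_(k <- msupp f) << p`_i *: f@_k *g (i + k)%N >>.

Lemma mcoeff_scale p f n :
  (modpoly_scale p f)@_n = \sum_(i < n.+1) p`_i *: f@_(n - i)%N.
Proof.
have E (i : nat) : (\sum_(k <- msupp f) << p`_i *: f@_k *g (i + k)%N >>)@_n
    = if (i <= n)%N then p`_i *: f@_(n - i)%N else 0.
  rewrite raddf_sum /=; case: leqP => [le_in|lt_ni]; last first.
    by apply: big1 => k _; rewrite mcoeffU gtn_eqF // ltn_addr.
  have D k : (<< p`_i *: f@_k *g (i + k)%N >>)@_n
      = p`_i *: f@_k *+ (k == n - i)%N.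
    by rewrite mcoeffU -{1}(subnKC le_in) eqn_add2l.
  under eq_bigr => k _ do rewrite D.
  case: (msuppP f (n - i)%N) => [in_f|out_f].
    rewrite (bigD1_seq (n - i)%N) ?fset_uniq //= eqxx big1 ?addr0 // => k.
    by move/negPf ->.
  rewrite scaler0 big1_seq // => k /andP[_ kf].
  by case: eqP kf out_f => // <- ->.
rewrite raddf_sum /= (eq_bigr _ (fun (i : 'I__) _ => E i)) -(big_mkord xpredT
  (fun i => if (i <= n)%N then p`_i *: f@_(n - i)%N else 0)) -(big_mkord xpredT
  (fun i => p`_i *: f@_(n - i)%N)).
pose m := maxn (size p) n.+1.
rewrite (big_nat_widen _ _ m) ?leq_maxl // [RHS](big_nat_widen _ _ m) ?leq_maxr //.
rewrite big_mkcond [RHS]big_mkcond /=; apply: eq_bigr => i _; rewrite ltnS.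
case: ltnP => // /leq_sizeP/(_ i (leqnn i)) ->.
by rewrite scale0r if_same.
Qed.

Fact modpoly_scale1 : left_id 1 modpoly_scale.
Proof.
move=> f; apply/malgP => n; rewrite mcoeff_scale big_ord_recl big1 => [|i _].
  by rewrite coef1 scale1r subn0 addr0.
by rewrite coef1 scale0r.
Qed.

Fact modpoly_scaleDr : right_distributive modpoly_scale +%R.
Proof.
move=> p f g; apply/malgP => n; rewrite mcoeffD !mcoeff_scale -big_split /=.
by apply: eq_bigr => i _; rewrite mcoeffD scalerDr.
Qed.

Fact modpoly_scaleDl f : {morph modpoly_scale^~ f : p q / p + q}.
Proof.
move=> p q; apply/malgP => n; rewrite mcoeffD !mcoeff_scale -big_split /=.
by apply: eq_bigr => i _; rewrite coefD scalerDl.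
Qed.

Fact mcoeff_scaleX f n :
  (modpoly_scale 'X f)@_n = if n is n'.+1 then f@_n' else 0.
Proof.
rewrite mcoeff_scale; case: n => [|n].
  by rewrite big_ord1 coefX scale0r.
rewrite !big_ord_recl !coefX /= scale0r scale1r add0r subSS subn0.
by rewrite big1 ?addr0 // => i _; rewrite coefX scale0r.
Qed.

Fact modpoly_scaleMX p f :
  modpoly_scale (p * 'X) f = modpoly_scale p (modpoly_scale 'X f).
Proof.
apply/malgP => n; rewrite !mcoeff_scale big_ord_recl big_ord_recr /=.
rewrite coefMX /= scale0r add0r subnn mcoeff_scaleX scaler0 addr0.
apply: eq_bigr => i _; rewrite coefMX /= mcoeff_scaleX.
by rewrite /bump add1n -(subnSK (ltn_ord i)).
Qed.

Fact modpoly_scaleXM p f :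
  modpoly_scale ('X * p) f = modpoly_scale 'X (modpoly_scale p f).
Proof.
apply/malgP => -[|n]; rewrite mcoeff_scaleX -commr_polyX mcoeff_scale.
  by rewrite big_ord1 coefMX scale0r.
rewrite mcoeff_scale big_ord_recl coefMX scale0r add0r.
by apply: eq_bigr => i _; rewrite coefMX.
Qed.

Fact modpoly_scaleCM c p f :
  modpoly_scale (c%:P * p) f = modpoly_scale c%:P (modpoly_scale p f).
Proof.
apply/malgP => n; rewrite [RHS]mcoeff_scale big_ord_recl big1 => [|i _].
  rewrite coefC /= addr0 subn0 !mcoeff_scale scaler_sumr.
  by apply: eq_bigr => i _; rewrite coefCM scalerA.
by rewrite coefC scale0r.
Qed.

Fact modpoly_scaleA p q f :
  modpoly_scale p (modpoly_scale q f) = modpoly_scale (p * q) f.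
Proof.
elim/poly_ind: p q f => [|p c IHp] q f.
  by rewrite mul0r; apply/malgP => n; rewrite !mcoeff_scale !big1 // => i _;
    rewrite coef0 scale0r.
rewrite mulrDl !modpoly_scaleDl modpoly_scaleMX -modpoly_scaleXM IHp.
by rewrite mulrA modpoly_scaleCM.
Qed.

HB.instance Definition _ := GRing.Zmodule_isLmodule.Build {poly R} (modpoly M)
  modpoly_scaleA modpoly_scale1 modpoly_scaleDr modpoly_scaleDl.

Definition modpolyC (m : M) : modpoly M := << m *g 0%N >>.

(* \sum_n x^n *: h m_n, for f = \sum_n m_n 'X^n: the value of f at 'X = x,    *)
(* with the coefficients transported along h.                                 *)
Definition modeval (S : nzRingType) (N : lmodType S) (h : M -> N) (x : S) f : N :=
  \sum_(n <- msupp f) x ^+ n *: h f@_n.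

End ModPoly.

Section Conformal.
Variables (F : fieldType) (A : lmodType {poly F}).
Variable lp : A -> A -> modpoly A.

Local Notation d := ('X : {poly F}).
Local Notation lambda1 := ('X : {poly {poly F}}).
Local Notation d1 := (('X)%:P : {poly {poly F}}).
Local Notation lambda := (('X)%:P : {poly {poly {poly F}}}).
Local Notation mu := ('X : {poly {poly {poly F}}}).

(* F acts on A and on A[lambda] through the constant polynomials.             *)
Definition is_conformal : Prop :=
  [/\ forall (c : F) a a' b,
        lp (c%:P *: a + a') b = c%:P%:P *: lp a b + lp a' b,
      forall (c : F) a b b',
        lp a (c%:P *: b + b') = c%:P%:P *: lp a b + lp a b',
      forall a b, lp (d *: a) b = - (lambda1 *: lp a b)
    & forall a b, lp a (d *: b) = (lambda1 + d1) *: lp a b].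

(* a_{- lambda - d} b; the coefficient of lambda^n in a_lambda b is already   *)
(* a_(n) b / n`!.                                                             *)
Definition lp_opp (a b : A) : modpoly A :=
  modeval (@modpolyC _ A) (- lambda1 - d1) (lp a b).

(* a_x b in A[lambda, mu], for x in F[d][lambda, mu]                          *)
Definition lp_at (x : {poly {poly {poly F}}}) (a b : A) : modpoly (modpoly A) :=
  modeval (fun e => modpolyC (modpolyC e)) x (lp a b).

Definition is_jacobi_jordan_conformal : Prop :=
  [/\ is_conformal,
      forall a b, lp a b = lp_opp b a
    & forall a b c,
        modeval (fun e => lp_at lambda a e) mu (lp b c)
        + modeval (fun e => lp_at (lambda + mu) e c) lambda (lp a b)
        + modeval (fun e => lp_at mu b e) lambda (lp a c) = 0].

(* A is the free F[d]-module over V, embedded by the F-linear map i: every    *)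
(* element of A is \sum_n d^n i(v_n) for a unique finitely supported (v_n).   *)
Definition is_free_over (V : lmodType F) (i : V -> A) : Prop :=
  linear_for (polyC \; *:%R) i /\ bijective (modeval i d).

Definition is_quadratic : Prop :=
  exists (V : lmodType F) (i : V -> A),
    is_free_over i /\
    forall a b : V, exists u v w : V,
      lp (i a) (i b) =
        modpolyC (d *: i u) + lambda1 *: modpolyC (i v) + modpolyC (i w).

Definition is_quadratic_jacobi_jordan_conformal : Prop :=
  is_jacobi_jordan_conformal /\ is_quadratic.

End Conformal.

Section MockGD.
Variables (F : fieldType) (V : lmodType F).

Definition is_jacobi_jordan (star : {bilinear V -> V -> V}) : Prop :=
  (forall a b, star a b = star b a) /\
  (forall a b c, star a (star b c) + star b (star c a) + star c (star a b) = 0).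

Definition anti_associator (circ : V -> V -> V) (a b c : V) : V :=
  circ (circ a b) c + circ a (circ b c).

Definition is_anti_novikov (circ : {bilinear V -> V -> V}) : Prop :=
  (forall a b c, circ a (circ b c) = - circ b (circ a c)) /\
  (forall a b c, anti_associator circ a b c + anti_associator circ a c b = 0).

Definition is_mock_GD (star circ : {bilinear V -> V -> V}) : Prop :=
  [/\ is_anti_novikov circ,
      is_jacobi_jordan star
    & forall a b c,
        circ a (star b c) + star a (circ b c) + circ (star a b) c
        + circ b (star a c) + star b (circ a c) = 0].

(* The extension to F[d]V of phi : V x V -> (F[d]V)[lambda] by conformal      *)
(* sesquilinearity:                                                           *)
(*   (d^m u)_lambda (d^n v) = (- lambda)^m (lambda + d)^n phi(u, v).          *)
Definition sesquilinear_ext (phi : V -> V -> modpoly (modpoly V))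
    (a b : modpoly V) : modpoly (modpoly V) :=
  modeval (fun u => modeval (phi u) ('X + ('X)%:P) b) (- 'X) a.

Definition gd_lp (star circ : {bilinear V -> V -> V}) :
    modpoly V -> modpoly V -> modpoly (modpoly V) :=
  sesquilinear_ext (fun u v =>
    modpolyC (modpolyC (star u v) + 'X *: modpolyC (circ u v))
    + 'X *: modpolyC (modpolyC (circ u v - circ v u))).

End MockGD.

(* Main.v *)
Require Import Defs.
From HB Require Import structures.
From mathcomp Require Import all_boot all_order all_algebra.
From mathcomp Require Import finmap monalg ring.

Set Implicit Arguments.
Unset Strict Implicit.
Unset Printing Implicit Defensive.

Import GRing.Theory.
Local Open Scope ring_scope.

(** Sesquilinearity determines both axioms of a Jacobi-Jordan conformal algebra
on generators.  The defect of commutativity and the left-hand side of the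
Jacobi identity,
  J(a, b, c) = a_lambda (b_mu c) + (a_lambda b)_{lambda+mu} c
               + b_mu (a_lambda c),
are additive in each argument, and d acts on the arguments of J through the
scalars - lambda, - mu and lambda + mu + d.  As F[d]V is spanned by the d^n v,
they vanish as soon as they vanish on V (gd_lp_commutative, gd_lp_jacobi).

On V, commutativity says that star is commutative.  Granting this, J(u, v, w)
is a polynomial of degree 2 in d, lambda and mu, with ten coefficients in V.
Write jj, cp, n1, n2 for the defects of the Jacobi identity of star, of the
compatibility of star and circ, and of the two anti-Novikov identities.  The
coefficients of 1, d and d^2 are jj, cp and n1 at (u, v, w), that of lambda^2
is n1(u,v,w) + n1(w,v,u) - n2(v,w,u), and each of the six others is again an
integral combination of permuted values of cp, n1 and n2
(jacobi_expansion).  Hence J = 0 if all four defects vanish; conversely the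
coefficients of 1, d, d^2 and lambda^2 recover them one after the other
(jacobi_normal_form_eq0).

The expansion is an identity between linear combinations in a module over
F[d][lambda][mu].  It becomes an identity in a commutative ring, and thus
decidable by normalisation, once the module M over S is placed inside its
trivial square-zero extension, the ring S + M with M^2 = 0. *)

(** * Polynomials with coefficients in a module *)

Section Modpoly.
Variables (R : nzRingType) (M : lmodType R).
Implicit Types (f g : modpoly M) (m : M).

Lemma mcoeffXZ f n : ('X *: f)@_n = if n is n'.+1 then f@_n' else 0.
Proof. exact: mcoeff_scaleX. Qed.

Lemma mcoeffCZ (c : R) f n : (c%:P *: f)@_n = c *: f@_n.
Proof.
rewrite [LHS]mcoeff_scale big_ord_recl coefC subn0 big1 ?addr0 // => i _.
by rewrite coefC scale0r.
Qed.

Lemma mcoeff_modpolyC m n : (modpolyC m)@_n = if n is 0%N then m else 0.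
Proof. by rewrite mcoeffU; case: n. Qed.

Lemma modpolyCD : {morph @modpolyC R M : m m' / m + m'}.
Proof. by move=> m m'; apply: monalgUD. Qed.

Lemma modpolyCZ (c : R) m : modpolyC (c *: m) = c%:P *: modpolyC m.
Proof.
apply/malgP => n; rewrite mcoeffCZ !mcoeff_modpolyC.
by case: n => // n; rewrite scaler0.
Qed.

HB.instance Definition _ :=
  GRing.isZmodMorphism.Build M (modpoly M) (@modpolyC R M)
    (@monalgU_is_additive _ _ _).

Lemma exprX_modpolyC m n : 'X^n *: modpolyC m = << m *g n >> :> modpoly M.
Proof.
elim: n => [|n IHn]; first by rewrite scale1r.
rewrite exprS -scalerA IHn; apply/malgP => -[|k].
  by rewrite mcoeffXZ mcoeffU.
by rewrite mcoeffXZ !mcoeffU.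
Qed.

Lemma modpoly_ind_monomial (P : modpoly M -> Prop) :
    (forall m n, P ('X^n *: modpolyC m)) ->
    (forall f g, P f -> P g -> P (f + g)) ->
  forall f, P f.
Proof.
move=> PX PD f; rewrite [f]monalgE; elim: (enum_fset _) => [|n s IHs].
  by have := PX 0 0%N; rewrite big_nil scale1r raddf0.
by rewrite big_cons; apply: PD; rewrite // -exprX_modpolyC.
Qed.

(** A property stable under sums and under the last variable only has to be
checked on constants.  This reduces the axioms of a conformal algebra on F[d]V
to generators in V. *)
Lemma modpoly_ind (P : modpoly M -> Prop) :
    (forall m, P (modpolyC m)) -> (forall f g, P f -> P g -> P (f + g)) ->
    (forall f, P f -> P ('X *: f)) ->
  forall f, P f.
Proof.
move=> PC PD PX; apply: modpoly_ind_monomial => // m.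
by elim=> [|n IHn]; rewrite ?scale1r // exprS -scalerA; apply: PX.
Qed.

Lemma modpolyC_eq0 m : modpolyC m = 0 -> m = 0.
Proof.
move/(congr1 (mcoeff 0%N)) => /=.
by rewrite [LHS]mcoeff_modpolyC [RHS]mcoeff0.
Qed.

(** Separates the constant term: repeated use reads off all coefficients of an
element written in Horner form. *)
Lemma modpolyCDX_eq0 m f : modpolyC m + 'X *: f = 0 -> m = 0 /\ f = 0.
Proof.
move=> f0; split; last apply/malgP => n.
  have := congr1 (mcoeff 0%N) f0.
  by rewrite mcoeffD mcoeff_modpolyC mcoeffXZ addr0 mcoeff0.
have := congr1 (mcoeff n.+1) f0.
by rewrite mcoeffD mcoeff_modpolyC mcoeffXZ add0r !mcoeff0.
Qed.

End Modpoly.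

(** * Evaluation along an additive map *)

Section Modeval.
Variables (R : nzRingType) (M : lmodType R) (S : nzRingType) (N : lmodType S).
Implicit Types (f g : modpoly M) (h : M -> N) (x y : S).

Lemma eq_modeval h h' x : h =1 h' -> modeval h x =1 modeval h' x.
Proof. by move=> eq_h f; apply: eq_bigr => n _; rewrite eq_h. Qed.

Lemma modeval_funD h h' x f :
  modeval (fun m => h m + h' m) x f = modeval h x f + modeval h' x f.
Proof. by rewrite -big_split; apply: eq_bigr => n _; rewrite scalerDr. Qed.

Lemma modeval_funZ h x y f :
  GRing.comm x y -> modeval (fun m => y *: h m) x f = y *: modeval h x f.
Proof.
move=> cxy; rewrite scaler_sumr; apply: eq_bigr => n _.
by rewrite !scalerA (commrX n (commr_sym cxy)).
Qed.

Variables (h : M -> N) (x : S).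
Hypothesis hD : {morph h : m m' / m + m'}.

Let h0 : h 0 = 0.
Proof. by apply: (addrI (h 0)); rewrite -hD !addr0. Qed.

(** The value as a sum over any set containing the support: a common set for
[f], [g] and [f + g] is what makes evaluation additive. *)
Lemma modeval_widen f (d : {fset nat}) : (msupp f `<=` d)%fset ->
  modeval h x f = \sum_(n <- d) x ^+ n *: h f@_n.
Proof.
move=> le_fd; apply: big_fset_incl => // n _ /mcoeff_outdom ->.
by rewrite h0 scaler0.
Qed.

Lemma modevalD : {morph modeval h x : f g / f + g}.
Proof.
move=> f g; pose d := (msupp f `|` msupp g `|` msupp (f + g))%fset.
rewrite !(@modeval_widen _ d).
- by rewrite -big_split; apply: eq_bigr => n _; rewrite mcoeffD hD scalerDr.
- by rewrite fsubsetU // fsubsetUr.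
- by rewrite fsubsetU // fsubsetUl.
- by rewrite fsubsetUr.
Qed.

Lemma modevalU m n : modeval h x ('X^n *: modpolyC m) = x ^+ n *: h m.
Proof.
by rewrite exprX_modpolyC (modeval_widen msuppU_le) big_seq_fset1 mcoeffUU.
Qed.

Lemma modevalC m : modeval h x (modpolyC m) = h m.
Proof. by rewrite -[modpolyC m]scale1r (modevalU m 0) scale1r. Qed.

Lemma modevalX f : modeval h x ('X *: f) = x *: modeval h x f.
Proof.
elim/modpoly_ind_monomial: f => [m n | f g IHf IHg].
  by rewrite scalerA -exprS !modevalU scalerA exprS.
by rewrite scalerDr !modevalD scalerDr IHf IHg.
Qed.

(** If [h] turns the scalar [c] into [y], so does evaluation along [h]; this is
how the action of d passes through a substitution for lambda. *)
Lemma modevalCZ c y : GRing.comm x y -> (forall m, h (c *: m) = y *: h m) ->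
  forall f, modeval h x (c%:P *: f) = y *: modeval h x f.
Proof.
move=> cxy hZ; elim/modpoly_ind_monomial=> [m n | f g IHf IHg].
  rewrite scalerA commr_polyXn -scalerA -modpolyCZ !modevalU hZ !scalerA.
  by rewrite (commrX n (commr_sym cxy)).
by rewrite scalerDr !modevalD scalerDr IHf IHg.
Qed.

Lemma modevalN f : modeval h x (- f) = - modeval h x f.
Proof.
apply: (addrI (modeval h x f)); rewrite -modevalD !subrr.
by rewrite -[0](raddf0 (@modpolyC R M)) modevalC.
Qed.

End Modeval.

(** * The Jacobi identity of a conformal algebra is sesquilinear *)

Section Conformal.
Variables (F : fieldType) (A : lmodType {poly F}).
Variable lp : A -> A -> modpoly A.
Hypothesis lp_conformal : is_conformal lp.
Implicit Types (a b c e : A).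

Local Notation S := {poly {poly {poly F}}}.
Local Notation d := ('X : {poly F}).
Local Notation lambda1 := ('X : {poly {poly F}}).
Local Notation d1 := (('X)%:P : {poly {poly F}}).
Local Notation d2 := (('X)%:P%:P : S).
Local Notation lambda := (('X)%:P : S).
Local Notation mu := ('X : S).
Local Notation CC := (fun e : A => modpolyC (modpolyC e)).

Lemma lpDl b : {morph lp^~ b : a a' / a + a'}.
Proof.
move=> a a'; case: lp_conformal => H _ _ _.
by have := H 1 a a' b; rewrite !polyC1 !scale1r.
Qed.

Lemma lpDr a : {morph lp a : b b' / b + b'}.
Proof.
move=> b b'; case: lp_conformal => _ H _ _.
by have := H 1 a b b'; rewrite !polyC1 !scale1r.
Qed.

Lemma lpXl a b : lp (d *: a) b = - lambda1 *: lp a b.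
Proof. by case: lp_conformal => _ _ H _; rewrite H scaleNr. Qed.

Lemma lpXr a b : lp a (d *: b) = (lambda1 + d1) *: lp a b.
Proof. by case: lp_conformal. Qed.

Lemma lp_oppDl b : {morph (lp_opp lp)^~ b : a a' / a + a'}.
Proof. by move=> a a'; rewrite /lp_opp lpDl modevalD //; apply: modpolyCD. Qed.

Lemma lp_oppDr a : {morph lp_opp lp a : b b' / b + b'}.
Proof. by move=> b b'; rewrite /lp_opp lpDr modevalD //; apply: modpolyCD. Qed.

(** The factors - lambda and lambda + d of sesquilinearity are exchanged by the
substitution of - lambda - d for lambda, so [lp_opp lp b a] obeys the same rules
in [a] and [b] as [lp a b]. *)
Lemma lp_oppXl a b : lp_opp lp (d *: a) b = (lambda1 + d1) *: lp_opp lp a b.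
Proof.
have CD := @modpolyCD _ A.
rewrite /lp_opp lpXl scaleNr modevalN // modevalX // -scaleNr.
by rewrite opprB opprK addrC.
Qed.

Lemma lp_oppXr a b : lp_opp lp a (d *: b) = - lambda1 *: lp_opp lp a b.
Proof.
have CD := @modpolyCD _ A.
rewrite /lp_opp lpXr scalerDl modevalD // modevalX //.
rewrite (@modevalCZ _ _ _ _ _ _ CD 'X d1); last 2 first.
- exact: mulrC.
- exact: modpolyCZ.
by rewrite -scalerDl subrK.
Qed.

Let CC_D : {morph CC : e e' / e + e'}.
Proof. by move=> e e'; rewrite !modpolyCD. Qed.

Lemma lp_atDl x c : {morph (lp_at lp x)^~ c : a a' / a + a'}.
Proof. by move=> a a'; rewrite /lp_at lpDl modevalD. Qed.

Lemma lp_atDr x a : {morph lp_at lp x a : c c' / c + c'}.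
Proof. by move=> c c'; rewrite /lp_at lpDr modevalD. Qed.

Lemma lp_atXl x a c : lp_at lp x (d *: a) c = - x *: lp_at lp x a c.
Proof. by rewrite /lp_at lpXl scaleNr modevalN // modevalX // scaleNr. Qed.

Lemma lp_atXr x a c : lp_at lp x a (d *: c) = (x + d2) *: lp_at lp x a c.
Proof.
rewrite /lp_at lpXr scalerDl modevalD // modevalX // scalerDl.
rewrite (@modevalCZ _ _ _ _ _ _ CC_D 'X d2) //; first exact: mulrC.
by move=> e; rewrite !modpolyCZ.
Qed.

(** The nested products a_x (b_y c) and (a_y b)_x c.  Keeping [x] and [y] generic
lets one set of rules serve the three terms of the Jacobi identity. *)
Definition lp_left x y a b c := modeval (fun e => lp_at lp x a e) y (lp b c).
Definition lp_right x y a b c := modeval (fun e => lp_at lp x e c) y (lp a b).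

Definition jacobiator a b c : modpoly (modpoly A) :=
  lp_left lambda mu a b c + lp_right (lambda + mu) lambda a b c
  + lp_left mu lambda b a c.

Section Nested.
Variables x y : S.

Lemma lp_leftD1 b c : {morph (fun a => lp_left x y a b c) : a a' / a + a'}.
Proof.
move=> a a'; rewrite -modeval_funD; apply: eq_modeval => e.
exact: lp_atDl.
Qed.

Lemma lp_leftD2 a c : {morph (fun b => lp_left x y a b c) : b b' / b + b'}.
Proof.
by move=> b b'; rewrite /lp_left lpDl modevalD //; apply: lp_atDr.
Qed.

Lemma lp_leftD3 a b : {morph lp_left x y a b : c c' / c + c'}.
Proof.
by move=> c c'; rewrite /lp_left lpDr modevalD //; apply: lp_atDr.
Qed.

Lemma lp_leftX1 a b c : lp_left x y (d *: a) b c = - x *: lp_left x y a b c.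
Proof.
rewrite -modeval_funZ; first by apply: eq_modeval => e; apply: lp_atXl.
exact: mulrC.
Qed.

Lemma lp_leftX2 a b c : lp_left x y a (d *: b) c = - y *: lp_left x y a b c.
Proof.
have atD := lp_atDr x a.
by rewrite /lp_left lpXl scaleNr modevalN // modevalX // scaleNr.
Qed.

Lemma lp_leftX3 a b c :
  lp_left x y a b (d *: c) = (x + y + d2) *: lp_left x y a b c.
Proof.
have atD := lp_atDr x a.
rewrite /lp_left lpXr scalerDl modevalD // modevalX //.
rewrite (@modevalCZ _ _ _ _ _ _ atD 'X (x + d2)); last 2 first.
- exact: mulrC.
- exact: lp_atXr.
by rewrite -scalerDl addrCA addrA.
Qed.

Lemma lp_rightD1 b c : {morph (fun a => lp_right x y a b c) : a a' / a + a'}.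
Proof.
by move=> a a'; rewrite /lp_right lpDl modevalD //; apply: lp_atDl.
Qed.

Lemma lp_rightD2 a c : {morph (fun b => lp_right x y a b c) : b b' / b + b'}.
Proof.
by move=> b b'; rewrite /lp_right lpDr modevalD //; apply: lp_atDl.
Qed.

Lemma lp_rightD3 a b : {morph lp_right x y a b : c c' / c + c'}.
Proof.
move=> c c'; rewrite -modeval_funD; apply: eq_modeval => e.
exact: lp_atDr.
Qed.

Lemma lp_rightX1 a b c : lp_right x y (d *: a) b c = - y *: lp_right x y a b c.
Proof.
have atD := lp_atDl x c.
by rewrite /lp_right lpXl scaleNr modevalN // modevalX // scaleNr.
Qed.

(** The factor lambda + d becomes y - x, since d acts on the inner product,
which is the left argument of the outer one, as - x.  For x = lambda + mu and
y = lambda this is the same - mu as for the two other terms. *)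
Lemma lp_rightX2 a b c :
  lp_right x y a (d *: b) c = (y - x) *: lp_right x y a b c.
Proof.
have atD := lp_atDl x c.
rewrite /lp_right lpXr scalerDl modevalD // modevalX //.
rewrite (@modevalCZ _ _ _ _ _ _ atD 'X (- x)) ?scalerDl //.
- exact: mulrC.
- by move=> e; apply: lp_atXl.
Qed.

Lemma lp_rightX3 a b c :
  lp_right x y a b (d *: c) = (x + d2) *: lp_right x y a b c.
Proof.
rewrite -modeval_funZ; first by apply: eq_modeval => e; apply: lp_atXr.
exact: mulrC.
Qed.

End Nested.

Lemma jacobiatorD1 b c : {morph (fun a => jacobiator a b c) : a a' / a + a'}.
Proof.
move=> a a'; rewrite /jacobiator lp_leftD1 lp_rightD1 lp_leftD2.
by rewrite [RHS]addrACA [X in _ = X + _]addrACA.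
Qed.

Lemma jacobiatorD2 a c : {morph (fun b => jacobiator a b c) : b b' / b + b'}.
Proof.
move=> b b'; rewrite /jacobiator lp_leftD2 lp_rightD2 lp_leftD1.
by rewrite [RHS]addrACA [X in _ = X + _]addrACA.
Qed.

Lemma jacobiatorD3 a b : {morph jacobiator a b : c c' / c + c'}.
Proof.
move=> c c'; rewrite /jacobiator !lp_leftD3 lp_rightD3.
by rewrite [RHS]addrACA [X in _ = X + _]addrACA.
Qed.

Lemma jacobiatorX1 a b c :
  jacobiator (d *: a) b c = - lambda *: jacobiator a b c.
Proof. by rewrite /jacobiator lp_leftX1 lp_rightX1 lp_leftX2 !scalerDr. Qed.

Lemma jacobiatorX2 a b c : jacobiator a (d *: b) c = - mu *: jacobiator a b c.
Proof.
rewrite /jacobiator lp_leftX1 lp_rightX2 lp_leftX2 !scalerDr.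
by rewrite opprD addNKr.
Qed.

Lemma jacobiatorX3 a b c :
  jacobiator a b (d *: c) = (lambda + mu + d2) *: jacobiator a b c.
Proof.
by rewrite /jacobiator !lp_leftX3 lp_rightX3 (addrC mu) !scalerDr.
Qed.

End Conformal.

(** * Reading off coefficients *)

(** Moves every scalar inside the embeddings that it came from.  Here [C1], [C2],
[C3] stand for three successive [modpolyC]: only additivity and the action on the
variables matter. *)
Lemma iterated_horner (R1 R2 R3 : nzRingType) (V : Type)
    (M1 : lmodType R1) (M2 : lmodType R2) (M3 : lmodType R3) (C1 : V -> M1)
    (C2 : {additive M1 -> M2}) (C3 : {additive M2 -> M3})
    (x1 : R1) (y1 x2 : R2) (z1 z2 : R3) (e0 e1 e2 f0 f1 f2 : V) :
    (forall m, C2 (x1 *: m) = y1 *: C2 m) ->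
    (forall m, C3 (y1 *: m) = z1 *: C3 m) ->
    (forall m, C3 (x2 *: m) = z2 *: C3 m) ->
  let K v := C3 (C2 (C1 v)) in
  K e0 + z1 *: (K e1 + z1 *: K e2) + z2 *: (K f0 + z1 *: K f1 + z2 *: K f2)
  = C3 (C2 (C1 e0 + x1 *: (C1 e1 + x1 *: C1 e2))
        + x2 *: (C2 (C1 f0 + x1 *: C1 f1) + x2 *: C2 (C1 f2))).
Proof. by move=> C2Z C3Z1 C3Z2 /=; rewrite !(raddfD, C2Z, C3Z1, C3Z2). Qed.

Lemma modpoly3_coef_eq0 (F : fieldType) (V : lmodType F)
    (e0 e1 e2 f0 f1 f2 : V) (r : modpoly (modpoly (modpoly V))) :
  let K v := modpolyC (modpolyC (modpolyC v)) in
  (K e0 + 'X%:P%:P *: (K e1 + 'X%:P%:P *: K e2))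
    + 'X%:P *: (K f0 + 'X%:P%:P *: K f1 + 'X%:P *: K f2) + 'X *: r = 0 ->
  [/\ e0 = 0, e1 = 0, e2 = 0 & f2 = 0].
Proof.
have fold := iterated_horner (@modpolyC _ V) e0 e1 e2 f0 f1 f2
  (@modpolyCZ _ (modpoly V) 'X) (@modpolyCZ _ (modpoly (modpoly V)) 'X%:P)
  (@modpolyCZ _ (modpoly (modpoly V)) 'X).
move=> K /(etrans (congr1 (+%R^~ ('X *: r)) (esym fold))).
move/modpolyCDX_eq0=> [/modpolyCDX_eq0[e0E fE] _].
move: e0E => /modpolyCDX_eq0[-> /modpolyCDX_eq0[-> /modpolyC_eq0 ->]].
by move: fE => /modpolyCDX_eq0[_ /modpolyC_eq0/modpolyC_eq0 ->].
Qed.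

(** * The trivial square-zero extension of a ring by a module *)

Definition trivext (S : comNzRingType) (M : lmodType S) : Type := (S * M)%type.

Section TrivialExtension.
Variables (S : comNzRingType) (M : lmodType S).
Local Notation E := (trivext M).

HB.instance Definition _ := GRing.Zmodule.copy E (S * M)%type.

Definition trivext_mul (z w : E) : E := (z.1 * w.1, z.1 *: w.2 + w.1 *: z.2).

Fact trivext_mulA : associative trivext_mul.
Proof.
move=> [r m] [s n] [t p]; congr (_, _) => /=; first exact: mulrA.
by rewrite !scalerDr !scalerA addrA (mulrC t r) (mulrC t s).
Qed.

Fact trivext_mulC : commutative trivext_mul.
Proof. by move=> [r m] [s n]; rewrite /trivext_mul /= mulrC addrC. Qed.

Fact trivext_mul1 : left_id ((1, 0) : E) trivext_mul.
Proof. by move=> [r m]; rewrite /trivext_mul /= mul1r scale1r scaler0 addr0. Qed.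

Fact trivext_mulDl : left_distributive trivext_mul +%R.
Proof.
move=> [r m] [s n] [t p]; congr (_, _) => /=; first exact: mulrDl.
by rewrite scalerDl scalerDr addrACA.
Qed.

Fact trivext_one_neq0 : ((1, 0) : E) != 0.
Proof. by apply/eqP => -[/eqP]; rewrite oner_eq0. Qed.

HB.instance Definition _ := GRing.Zmodule_isComNzRing.Build E
  trivext_mulA trivext_mulC trivext_mul1 trivext_mulDl trivext_one_neq0.

Definition trivext_scalar (s : S) : E := (s, 0).
Definition trivext_vector (m : M) : E := (0, m).

Fact trivext_scalar_is_additive : zmod_morphism trivext_scalar.
Proof. by move=> r s; congr (_, _); rewrite subr0. Qed.

Fact trivext_scalar_is_monoid_morphism : monoid_morphism trivext_scalar.
Proof.
by split=> // r s; congr (_, _); rewrite /= !scaler0 addr0.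
Qed.

Fact trivext_vector_is_additive : zmod_morphism trivext_vector.
Proof. by move=> m n; congr (_, _); rewrite subr0. Qed.

HB.instance Definition _ :=
  GRing.isZmodMorphism.Build S E trivext_scalar trivext_scalar_is_additive.
HB.instance Definition _ :=
  GRing.isMonoidMorphism.Build S E trivext_scalar
    trivext_scalar_is_monoid_morphism.
HB.instance Definition _ :=
  GRing.isZmodMorphism.Build M E trivext_vector trivext_vector_is_additive.

(** With this rule the embedding of [M] turns linear combinations in [M] into
ring expressions. *)
Lemma trivext_vectorZ s m :
  trivext_vector (s *: m) = trivext_scalar s * trivext_vector m.
Proof. by congr (_, _); rewrite /= ?mul0r ?mulr0 ?scale0r ?addr0. Qed.

Lemma trivext_vectorD : {morph trivext_vector : m n / m + n}.
Proof. exact: raddfD. Qed.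

Lemma trivext_vectorN : {morph trivext_vector : m / - m}.
Proof. exact: raddfN. Qed.

Lemma trivext_vector_inj : injective trivext_vector.
Proof. by move=> m n []. Qed.

End TrivialExtension.

(** * The Jacobi identity on generators *)

Section Defects.
Variables (F : fieldType) (V : lmodType F) (star circ : {bilinear V -> V -> V}).

Definition jacobi_defect u v w :=
  star u (star v w) + star v (star w u) + star w (star u v).

Definition compatibility_defect u v w :=
  circ u (star v w) + star u (circ v w) + circ (star u v) w
  + circ v (star u w) + star v (circ u w).

Definition left_defect u v w := circ u (circ v w) + circ v (circ u w).

Definition associator_defect u v w :=
  anti_associator circ u v w + anti_associator circ u w v.

Variables (S : comNzRingType) (M : lmodType S) (K : V -> M) (d x y : S).

(** The product of two generators at lambda = [z].  It is defined over any module
that receives [V], as it occurs both in one and in two variables over F[d]. *)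
Definition gd_at (z : S) (u v : V) :=
  K (star u v) + d *: K (circ u v) + z *: K (circ u v - circ v u).

(** The coefficients are grouped as d-part + x * (...) + y * (...), with [x] and [y]
standing for lambda and mu, so that constant terms split off in turn. *)
Definition jacobi_normal_form u v w :=
  (K (jacobi_defect u v w)
   + d *: (K (compatibility_defect u v w) + d *: K (left_defect u v w)))
  + x *: (K (compatibility_defect u v w - compatibility_defect v w u)
          + d *: K (left_defect u v w *+ 2 - associator_defect v w u)
          + x *: K (left_defect u v w + left_defect w v u
                    - associator_defect v w u))
  + y *: (K (compatibility_defect v u w - compatibility_defect u w v)
          + d *: K (left_defect u v w *+ 2 - associator_defect u w v)
          + x *: K (left_defect u v w *+ 2 - associator_defect v w u
                    - associator_defect u w v + associator_defect w u v)
          + y *: K (left_defect v u w + left_defect w u v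
                    - associator_defect u w v)).

End Defects.

(** The three summands on the left are u_x (v_y w), (u_x v)_{x+y} w and v_y (u_x w).
The factors x + d, - (x + y) and y + d come from sesquilinearity applied to the
term d (_ circ _) of the inner product. *)
Lemma jacobi_expansion (F : fieldType) (V : lmodType F)
    (star circ : {bilinear V -> V -> V})
    (starC : forall u v, star u v = star v u)
    (S : comNzRingType) (M : lmodType S) (K : {additive V -> M}) (d x y : S)
    (u v w : V) :
  let at_ := gd_at star circ K d in
  at_ x u (star v w) + (x + d) *: at_ x u (circ v w)
    + y *: at_ x u (circ v w - circ w v)
  + (at_ (x + y) (star u v) w - (x + y) *: at_ (x + y) (circ u v) w
     + x *: at_ (x + y) (circ u v - circ v u) w)
  + (at_ y v (star u w) + (y + d) *: at_ y v (circ u w)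
     + x *: at_ y v (circ u w - circ w u))
  = jacobi_normal_form star circ K d x y u v w.
Proof.
move=> /=; apply: trivext_vector_inj.
rewrite /gd_at /jacobi_normal_form /jacobi_defect /compatibility_defect.
rewrite /left_defect /associator_defect /anti_associator.
rewrite !(linearBl, linearBr).
rewrite !(trivext_vectorZ, trivext_vectorD, trivext_vectorN).
(* The coefficients agree only up to commutativity of star: bring every product
   of star to one orientation. *)
rewrite !(starC (circ _ _)) (starC (star u v)) (starC v w).
rewrite (starC v u) (starC w u).
ring.
Qed.

Section GelfandDorfmanCombination.
Variables (F : fieldType) (V : lmodType F) (star circ : {bilinear V -> V -> V}).
Variables (S : comNzRingType) (M : lmodType S).
Variables (K : {additive V -> M}) (d z : S).
Local Notation at_ := (gd_at star circ K d z).

Lemma gd_atDl v : {morph at_^~ v : u u' / u + u'}.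
Proof.
move=> u u'; apply: trivext_vector_inj; rewrite /gd_at !(linearDl, linearDr).
by rewrite !(trivext_vectorZ, trivext_vectorD); ring.
Qed.

Lemma gd_atDr u : {morph at_ u : v v' / v + v'}.
Proof.
move=> v v'; apply: trivext_vector_inj; rewrite /gd_at !(linearDl, linearDr).
by rewrite !(trivext_vectorZ, trivext_vectorD); ring.
Qed.

Lemma gd_atZl (c : F) (s : S) u v :
  (forall w, K (c *: w) = s *: K w) -> at_ (c *: u) v = s *: at_ u v.
Proof.
move=> KZ; rewrite /gd_at !linearZl_LR !linearZr_LR -scalerBr !KZ !scalerDr.
by rewrite !scalerA (mulrC d) (mulrC z).
Qed.

Lemma gd_atZr (c : F) (s : S) u v :
  (forall w, K (c *: w) = s *: K w) -> at_ u (c *: v) = s *: at_ u v.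
Proof.
move=> KZ; rewrite /gd_at !linearZl_LR !linearZr_LR -scalerBr !KZ !scalerDr.
by rewrite !scalerA (mulrC d) (mulrC z).
Qed.

(** Skew-symmetry of the lambda-coefficient is what makes the substitution of
- lambda - d absorb the exchange of circ u v and circ v u. *)
Lemma gd_at_swap u v : star u v = star v u ->
  at_ u v = K (star v u) + d *: K (circ v u)
            - (z + d) *: K (circ v u - circ u v).
Proof.
move=> starC; apply: trivext_vector_inj; rewrite /gd_at starC.
by rewrite !(trivext_vectorZ, trivext_vectorD, trivext_vectorN); ring.
Qed.

End GelfandDorfmanCombination.

(** * The conformal algebra of two bilinear operations *)

Section GelfandDorfman.
Variables (F : fieldType) (V : lmodType F) (star circ : {bilinear V -> V -> V}).

Local Notation S := {poly {poly {poly F}}}.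
Local Notation d := ('X : {poly F}).
Local Notation lambda1 := ('X : {poly {poly F}}).
Local Notation d1 := (('X)%:P : {poly {poly F}}).
Local Notation d2 := (('X)%:P%:P : S).
Local Notation lambda := (('X)%:P : S).
Local Notation mu := ('X : S).
Local Notation lp := (gd_lp star circ).
Local Notation C := (@modpolyC _ V).
Local Notation CC := (fun v : V => modpolyC (modpolyC v)).
Local Notation CCC := (fun v : V => modpolyC (modpolyC (modpolyC v))).
Local Notation at2 := (gd_at star circ CCC d2).
Local Notation "[ u , v ]" := (circ u v - circ v u).

Let CCadd : {additive V -> modpoly (modpoly V)} := @modpolyC _ _ \o C.
Let CCCadd : {additive V -> modpoly (modpoly (modpoly V))} :=
  @modpolyC _ _ \o (@modpolyC _ _ \o C).

Let CCaddZ (c : F) v : CCadd (c *: v) = c%:P%:P *: CCadd v.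
Proof. by rewrite /= !modpolyCZ. Qed.

(** The product on generators of which [gd_lp] is the sesquilinear extension. *)
Definition gd_gen (u v : V) : modpoly (modpoly V) :=
  modpolyC (modpolyC (star u v) + 'X *: modpolyC (circ u v))
  + 'X *: modpolyC (modpolyC (circ u v - circ v u)).

Lemma gd_genE u v :
  gd_gen u v = CC (star u v) + d1 *: CC (circ u v) + lambda1 *: CC [u, v].
Proof. by rewrite /gd_gen modpolyCD modpolyCZ. Qed.

Let gd_gen_at : gd_gen =2 gd_at star circ CCadd d1 lambda1.
Proof. exact: gd_genE. Qed.

Let gd_genDl v : {morph gd_gen^~ v : u u' / u + u'}.
Proof. by move=> u u'; rewrite !gd_gen_at; apply: gd_atDl. Qed.

Let gd_genDr u : {morph gd_gen u : v v' / v + v'}.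
Proof. by move=> v v'; rewrite !gd_gen_at; apply: gd_atDr. Qed.

Let gd_genZl (c : F) u v : gd_gen (c *: u) v = c%:P%:P *: gd_gen u v.
Proof. by rewrite !gd_gen_at; apply: gd_atZl => w; apply: CCaddZ. Qed.

Let gd_genZr (c : F) u v : gd_gen u (c *: v) = c%:P%:P *: gd_gen u v.
Proof. by rewrite !gd_gen_at; apply: gd_atZr => w; apply: CCaddZ. Qed.

Let ext u b := modeval (gd_gen u) (lambda1 + d1) b.

Let extD b : {morph ext^~ b : u u' / u + u'}.
Proof.
by move=> u u'; rewrite -modeval_funD; apply: eq_modeval => v; apply: gd_genDl.
Qed.

Let extZ (c : F) u b : ext (c *: u) b = c%:P%:P *: ext u b.
Proof.
rewrite -modeval_funZ; first by apply: eq_modeval => v; apply: gd_genZl.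
exact: mulrC.
Qed.

Lemma gd_lp_gen u v : lp (C u) (C v) = gd_gen u v.
Proof.
have D := gd_genDr u.
by rewrite [LHS](modevalC _ (extD _)) [LHS](modevalC _ D).
Qed.

Lemma gd_lp_conformal : is_conformal lp.
Proof.
split=> [c a a' b|c a b b'|a b|a b].
- rewrite [LHS](modevalD _ (extD b)); congr (_ + _).
  by apply: (modevalCZ (extD b)) => [|u]; [apply: mulrC | apply: extZ].
- rewrite -modeval_funZ; last exact: mulrC.
  rewrite -modeval_funD; apply: eq_modeval => u.
  have D := gd_genDr u; rewrite modevalD //; congr (_ + _).
  by apply: (modevalCZ D) => [|v]; [apply: mulrC | apply: gd_genZr].
- by rewrite [LHS](modevalX _ (extD b)) scaleNr.
- rewrite -modeval_funZ; last exact: mulrC.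
  by apply: eq_modeval => u; apply: modevalX; apply: gd_genDr.
Qed.

Lemma modpolyC_free : is_free_over C.
Proof.
split; first by move=> c u v; rewrite modpolyCD modpolyCZ.
suff id_modeval f : modeval C d f = f by exists id => f; rewrite id_modeval.
have CD := @modpolyCD _ V.
elim/modpoly_ind_monomial: f => [v n|f g IHf IHg].
  exact: modevalU.
by rewrite modevalD // IHf IHg.
Qed.

Lemma gd_lp_quadratic : is_quadratic lp.
Proof.
exists V, C; split=> [|u v]; first exact: modpolyC_free.
exists (circ u v), [u, v], (star u v).
by rewrite gd_lp_gen gd_genE modpolyCZ -addrA addrC.
Qed.

Lemma lp_oppC u v : lp_opp lp (C u) (C v) =
  CC (star u v) + d1 *: CC (circ u v) - (lambda1 + d1) *: CC [u, v].
Proof.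
have CD := @modpolyCD _ (modpoly V).
have CZ f : modeval (@modpolyC _ (modpoly V)) (- lambda1 - d1) (d1 *: f)
    = d1 *: modeval (@modpolyC _ (modpoly V)) (- lambda1 - d1) f.
  by apply: modevalCZ => // [|m]; [apply: mulrC | apply: modpolyCZ].
rewrite /lp_opp gd_lp_gen gd_genE !modevalD // modevalX // CZ.
by rewrite !modevalC // -opprD scaleNr.
Qed.

(** The constant coefficient gives the commutativity of star; the coefficients of
d and lambda match for any circ. *)
Lemma gd_lp_commutative :
  (forall a b, lp a b = lp_opp lp b a) <-> (forall u v, star u v = star v u).
Proof.
have conf := gd_lp_conformal; split=> [lpC u v | starC].
  have := congr1 (fun f : modpoly (modpoly V) => f@_0%N@_0%N) (lpC (C u) (C v)).
  rewrite gd_lp_gen gd_genE lp_oppC scalerDl.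
  rewrite !(mcoeffD, mcoeffN, mcoeffCZ, mcoeffXZ, mcoeff_modpolyC).
  by rewrite !(mcoeff0, oppr0, addr0).
elim/modpoly_ind=> [u|a a' IHa IHa'|a IHa] b.
- elim/modpoly_ind: b => [v|b b' IHb IHb'|b IHb].
  + rewrite gd_lp_gen gd_genE lp_oppC.
    exact: (gd_at_swap circ CCadd d1 lambda1 (starC u v)).
  + by rewrite (lpDr conf) (lp_oppDl conf) IHb IHb'.
  + by rewrite (lpXr conf) (lp_oppXl conf) IHb.
- by rewrite (lpDl conf) (lp_oppDr conf) IHa IHa'.
- by rewrite (lpXl conf) (lp_oppXr conf) IHa.
Qed.

Let CCD : {morph (fun e : modpoly V => modpolyC (modpolyC e)) : e e' / e + e'}.
Proof. by move=> e e'; rewrite !modpolyCD. Qed.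

Lemma lp_at_gen x u v : lp_at lp x (C u) (C v) = at2 x u v.
Proof.
have CZ f : modeval (fun e : modpoly V => modpolyC (modpolyC e)) x (d1 *: f)
    = d2 *: modeval (fun e : modpoly V => modpolyC (modpolyC e)) x f.
  by apply: modevalCZ => // [|m]; [apply: mulrC | rewrite !modpolyCZ].
rewrite /lp_at gd_lp_gen gd_genE !(modevalD _ CCD) (modevalX _ CCD) CZ.
by rewrite !(modevalC _ CCD).
Qed.

Lemma lp_left_gen x y u v w : lp_left lp x y (C u) (C v) (C w) =
  at2 x u (star v w) + (x + d2) *: at2 x u (circ v w)
  + y *: at2 x u [v, w].
Proof.
have conf := gd_lp_conformal; have D := lp_atDr conf x (C u).
rewrite /lp_left gd_lp_gen gd_genE !(modevalD _ D) (modevalX _ D).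
have DZ f : modeval (lp_at lp x (C u)) y (d1 *: f)
    = (x + d2) *: modeval (lp_at lp x (C u)) y f.
  by apply: (modevalCZ D); [apply: mulrC | apply: lp_atXr].
by rewrite DZ !(modevalC _ D) !lp_at_gen.
Qed.

Lemma lp_right_gen x y u v w : lp_right lp x y (C u) (C v) (C w) =
  at2 x (star u v) w - x *: at2 x (circ u v) w
  + y *: at2 x [u, v] w.
Proof.
have conf := gd_lp_conformal; have D := lp_atDl conf x (C w).
rewrite /lp_right gd_lp_gen gd_genE !(modevalD _ D) (modevalX _ D).
have DZ f : modeval (lp_at lp x ^~ (C w)) y (d1 *: f)
    = - x *: modeval (lp_at lp x ^~ (C w)) y f.
  by apply: (modevalCZ D) => [|e]; [apply: mulrC | apply: lp_atXl].
by rewrite DZ scaleNr !(modevalC _ D) !lp_at_gen.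
Qed.

Lemma jacobiator_gen (starC : forall u v, star u v = star v u) u v w :
  jacobiator lp (C u) (C v) (C w) =
    jacobi_normal_form star circ CCC d2 lambda mu u v w.
Proof.
rewrite /jacobiator !lp_left_gen lp_right_gen.
exact: (jacobi_expansion circ starC CCCadd d2 lambda mu u v w).
Qed.

Lemma gd_lp_jacobi (starC : forall u v, star u v = star v u) :
  (forall a b c, jacobiator lp a b c = 0) <->
  (forall u v w, jacobi_normal_form star circ CCC d2 lambda mu u v w = 0).
Proof.
have conf := gd_lp_conformal.
split=> [J0 u v w|N0]; first by rewrite -jacobiator_gen.
elim/modpoly_ind=> [u|a a' IHa IHa'|a IHa] b c; last 2 first.
- by rewrite (jacobiatorD1 conf) IHa IHa' addr0.
- by rewrite (jacobiatorX1 conf) IHa scaler0.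
elim/modpoly_ind: b => [v|b b' IHb IHb'|b IHb]; last 2 first.
- by rewrite (jacobiatorD2 conf) IHb IHb' addr0.
- by rewrite (jacobiatorX2 conf) IHb scaler0.
elim/modpoly_ind: c => [w|c c' IHc IHc'|c IHc]; last 2 first.
- by rewrite (jacobiatorD3 conf) IHc IHc' addr0.
- by rewrite (jacobiatorX3 conf) IHc scaler0.
by rewrite jacobiator_gen.
Qed.

(** The coefficient of lambda^2 involves associator_defect only up to values of
left_defect, which vanish by the coefficient of d^2. *)
Lemma jacobi_normal_form_eq0 :
  (forall u v w, jacobi_normal_form star circ CCC d2 lambda mu u v w = 0) <->
  [/\ forall u v w, jacobi_defect star u v w = 0,
      forall u v w, compatibility_defect star circ u v w = 0,
      forall u v w, left_defect circ u v w = 0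
    & forall u v w, associator_defect circ u v w = 0].
Proof.
split=> [N0|[jj0 cp0 n10 n20] u v w]; last first.
  rewrite /jacobi_normal_form jj0 !cp0 !n10 !n20 !(mul0rn, subr0, addr0).
  rewrite [modpolyC _](raddf0 CCCadd).
  by rewrite !(scaler0, addr0).
have coefs u v w := modpoly3_coef_eq0 (N0 u v w).
have n10 u v w : left_defect circ u v w = 0 by case: (coefs u v w).
split=> // u v w; try by case: (coefs u v w).
(* The lambda^2-coefficient at (a, b, c) has - n2(b, c, a). *)
case: (coefs w u v) => _ _ _; rewrite !n10 addr0 sub0r.
by move/eqP; rewrite oppr_eq0 => /eqP.
Qed.

Lemma mock_GD_defects (starC : forall u v, star u v = star v u) :
  is_mock_GD star circ <->
  [/\ forall u v w, jacobi_defect star u v w = 0,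
      forall u v w, compatibility_defect star circ u v w = 0,
      forall u v w, left_defect circ u v w = 0
    & forall u v w, associator_defect circ u v w = 0].
Proof.
split=> [[[n1 n2] [_ jj] cp]|[jj cp n1 n2]]; split=> //.
- by move=> u v w; rewrite /left_defect n1 addNr.
- by split=> // u v w; apply/eqP; rewrite -addr_eq0 [_ + _]n1.
Qed.

End GelfandDorfman.

Theorem theorem3p6 (F : fieldType) (charF0 : [pchar F] =i pred0)
    (V : lmodType F) (star circ : {bilinear V -> V -> V}) :
  is_quadratic_jacobi_jordan_conformal (gd_lp star circ) <-> is_mock_GD star circ.
Proof.
split=> [[[_ lpC J] _] | GD].
  have starC := (gd_lp_commutative star circ).1 lpC.
  apply/(mock_GD_defects circ starC)/jacobi_normal_form_eq0.
  exact/(gd_lp_jacobi circ starC).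
have starC : forall u v, star u v = star v u by case: GD => _ [].
split; last exact: gd_lp_quadratic.
split; [exact: gd_lp_conformal | exact/gd_lp_commutative |].
apply/(gd_lp_jacobi circ starC)/jacobi_normal_form_eq0.
exact/(mock_GD_defects circ starC).
Qed.
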